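(* Let $m,l,t$ be positive integers with $m\ge tl$, let $\mathcal G\subset\binom{[m]}l$ be a family, and let $\alpha:=|\mathcal G|/\binom ml$. Let $\mathcal B$ be chosen uniformly at random among all $t$-tuples of pairwise disjoint $l$-element subsets of $[m]$, and let $\eta:=|\mathcal G\cap\mathcal B|$ be the number of sets in $\mathcal B$ that belong to $\mathcal G$. Then for any positive $\beta$, $$\Pr\big[|\eta-\alpha t|\ge2\beta\sqrt t\big]\le2e^{-\beta^2/2}.$$
   Context: $[m]=\{1,\dots,m\}$ and $\binom{[m]}l$ is the family of all $l$-element subsets of $[m]$. *)

(* Defs.v *)
From HB Require Import structures.
From mathcomp Require Import all_boot all_order all_algebra.
From mathcomp Require Import reals sequences exp.

Set Implicit Arguments.
Unset Strict Implicit.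
Unset Printing Implicit Defensive.

Import Order.TTheory GRing.Theory Num.Theory.

Local Open Scope ring_scope.

(* The ground set [m] = {1, ..., m} is represented by 'I_m. *)
Definition l_subsets (m l : nat) : {set {set 'I_m}} :=
  [set S : {set 'I_m} | #|S| == l].

Definition disjoint_tuples (m l t : nat) : {set t.-tuple {set 'I_m}} :=
  [set B : t.-tuple {set 'I_m} |
    [forall i : 'I_t, tnth B i \in l_subsets m l] &&
    [forall i : 'I_t, forall j : 'I_t,
      (i != j) ==> [disjoint tnth B i & tnth B j]]].

(* Probability of the event E for an element chosen uniformly at random from
   the finite set Omega; it is meaningful only when Omega is nonempty (for
   Omega = disjoint_tuples m l t this is ensured by t * l <= m). *)
Definition unif_pr (R : realType) (T : finType) (Omega : {set T})
    (E : pred T) : R :=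
  #|[set x in Omega | E x]|%:R / #|Omega|%:R.

Definition family_density (R : realType) (m l : nat)
    (G : {set {set 'I_m}}) : R :=
  #|G|%:R / 'C(m, l)%:R.

(* Counts distinct sets; the entries of a tuple of pairwise disjoint nonempty
   sets are distinct, so this is also the number of indices i with B_i in G. *)
Definition hits (m t : nat) (G : {set {set 'I_m}})
    (B : t.-tuple {set 'I_m}) : nat :=
  #|G :&: [set S in B]|.

(* Main.v *)
(* Draw the blocks one at a time: with [a(M)] the density of [G] among
   the [l]-subsets of [M], the martingale E[eta | B_1 .. B_i] moves by
   [1[B_i in G] - a(M)] plus [s * (a(M :\: B_i) - a(M))], where [s] blocks
   remain to be drawn after [B_i].  The second term is not bounded by a
   constant, so Azuma's inequality does not apply.  Instead [B_i] is itself
   removed one element at a time: deleting a random element from [M] with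
   #|M| = N changes [a(M)] by at most [l / N], by 0 on average, and, by
   Bessel's inequality, with variance at most [l / (4 (N - 1) (N - l))].
   Since N >= s * l throughout, the block increment has bounded variance, whence
   E exp(lam (eta - a t)) <= exp(2 lam^2 t) for |lam| <= 1/4.  This range of
   [lam] is enough, because |eta - a t| <= t makes the event empty unless
   [beta <= sqrt t / 2], and the Chernoff bound uses
   [lam = beta / (2 sqrt t)]. *)
Require Import Defs.
From HB Require Import structures.
From mathcomp Require Import all_boot all_order all_algebra.
From mathcomp Require Import reals sequences exp.
From mathcomp Require Import ring lra.

Set Implicit Arguments.
Unset Strict Implicit.
Unset Printing Implicit Defensive.

Import Order.TTheory GRing.Theory Num.Theory.

Local Open Scope ring_scope.

(** * Exponential moments of averages over a finite set *)

(** Cubing [1 - x / 3 <= expR (- (x / 3))] gives [expR x * (1 - x / 3) ^+ 3 <= 1], and what is left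
    is a polynomial inequality. With the square of [1 - x / 2] instead, that inequality would fail
    at [x = 1/2]. *)
Lemma expR_le_quadratic (R : realType) (x : R) :
  `|x| <= 2^-1 -> expR x <= 1 + x + x ^+ 2.
Proof.
rewrite ler_norml => /andP[x_ge x_le].
have e1 : 1 - x / 3 <= expR (- (x / 3)) by exact: expR_ge1Dx.
have e3 : expR x * expR (- (x / 3)) ^+ 3 = 1.
  by rewrite -expRM_natl -expRD -[RHS]expR0; congr expR; lra.
have p3 : 0 <= (1 - x / 3) ^+ 3 by rewrite exprn_ge0 //; lra.
have le3 : (1 - x / 3) ^+ 3 <= expR (- (x / 3)) ^+ 3.
  by apply: lerXn2r; rewrite ?nnegrE ?expR_ge0 //; lra.
have ex0 : 0 < expR x := expR_gt0 x.
have le1 : expR x * (1 - x / 3) ^+ 3 <= 1.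
  by rewrite -[leRHS]e3 ler_pM2l.
have pos3 : 0 < (1 - x / 3) ^+ 3 by rewrite exprn_gt0 //; lra.
rewrite -(ler_pM2r pos3); apply: le_trans le1 _.
(* The cofactor of [x ^+ 2] stays positive up to [x = 1/2], where it is [11/8] before the division
   by 27. *)
have -> : (1 + x + x ^+ 2) * (1 - x / 3) ^+ 3 =
  1 + x ^+ 2 * (9 - 19 * x + 8 * x ^+ 2 - x ^+ 3) / 27 by lra.
rewrite lerDl divr_ge0 // mulr_ge0 ?sqr_ge0 //.
have : x ^+ 3 <= x ^+ 2 by rewrite exprS; nra.
nra.
Qed.

Definition avg (R : realType) (I : finType) (A : {set I}) (F : I -> R) : R :=
  (\sum_(x in A) F x) / #|A|%:R.

Section Averages.
Variables (R : realType) (I : finType) (A : {set I}).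
Implicit Types F H : I -> R.

Lemma eq_avg F H : {in A, F =1 H} -> avg A F = avg A H.
Proof. by move=> eqFH; rewrite /avg (eq_bigr _ eqFH). Qed.

Lemma avg_le F H : {in A, forall x, F x <= H x} -> avg A F <= avg A H.
Proof. by move=> leFH; rewrite ler_wpM2r ?invr_ge0 ?ler0n ?ler_sum. Qed.

Lemma avg_ge0 F : {in A, forall x, 0 <= F x} -> 0 <= avg A F.
Proof. by move=> F_ge0; rewrite divr_ge0 ?ler0n ?sumr_ge0. Qed.

Lemma avgD F H : avg A (fun x => F x + H x) = avg A F + avg A H.
Proof. by rewrite /avg big_split mulrDl. Qed.

Lemma avgZ c F : avg A (fun x => c * F x) = c * avg A F.
Proof. by rewrite /avg -mulr_sumr mulrA. Qed.

Hypothesis A_gt0 : (0 < #|A|)%N.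

Lemma avg_cst (c : R) : avg A (fun=> c) = c.
Proof. by rewrite /avg sumr_const -[c *+ _]mulr_natr mulfK // pnatr_eq0 -lt0n. Qed.

Lemma avg_le_cst c F : {in A, forall x, F x <= c} -> avg A F <= c.
Proof. by move=> leFc; rewrite -[leRHS]avg_cst; apply: avg_le. Qed.

(** The linear term of the quadratic bound averages to 0, which leaves [1 + v <= expR v]. Unlike
    Hoeffding's lemma, this exploits a variance much smaller than the range. *)
Lemma avg_expR_le F v :
  avg A F = 0 -> {in A, forall x, `|F x| <= 2^-1} ->
  avg A (fun x => F x ^+ 2) <= v -> avg A (fun x => expR (F x)) <= expR v.
Proof.
move=> F0 F_le F2; apply: le_trans (expR_ge1Dx v).
apply: (@le_trans _ _ (avg A (fun x => 1 + F x + F x ^+ 2))).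
  by apply: avg_le => x xA; apply: expR_le_quadratic; apply: F_le.
by rewrite !avgD avg_cst F0 addr0 lerD2l.
Qed.

(** Since [F ^+ 2 <= F], the variance is at most [a - a ^+ 2]. *)
Lemma avg_sqr_centered_le F :
  {in A, forall x, 0 <= F x <= 1} ->
  avg A (fun x => (F x - avg A F) ^+ 2) <= 4^-1.
Proof.
move=> F01; set a := avg A F.
apply: (@le_trans _ _ (avg A (fun x => (1 - 2 * a) * F x + a ^+ 2))).
  apply: avg_le => x xA; have := F01 x xA; nra.
by rewrite avgD avgZ avg_cst -/a; have := sqr_ge0 (a - 2^-1); lra.
Qed.

(** The variance bound would allow [mu ^+ 2 / 4]; the exponent here is the one that
    [avg_expR_density_block] reaches for the other part of the increment. *)
Lemma avg_expR_centered_le F mu :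
  {in A, forall x, 0 <= F x <= 1} -> `|mu| <= 2^-1 ->
  avg A (fun x => expR (mu * (F x - avg A F))) <= expR (mu ^+ 2 / 2).
Proof.
move=> F01 mu_le; set a := avg A F.
have /andP[a_ge0 a_le1] : 0 <= a <= 1.
  by rewrite avg_ge0 ?avg_le_cst // => x /F01/andP[].
apply: avg_expR_le => [|x xA|].
- by rewrite avgZ avgD avg_cst subrr mulr0.
- rewrite normrM; apply: le_trans mu_le; rewrite ler_piMr //.
  by rewrite ler_norml; have := F01 x xA; lra.
rewrite (@eq_avg _ (fun x => mu ^+ 2 * (F x - a) ^+ 2)); last first.
  by move=> x _; rewrite exprMn.
rewrite avgZ; apply: ler_wpM2l; first exact: sqr_ge0.
by apply: le_trans (avg_sqr_centered_le F01) _; lra.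
Qed.

End Averages.

(** * Uniform subsets of fixed size *)

Definition draws (T : finType) (M : {set T}) (k : nat) : {set {set T}} :=
  [set B : {set T} | (B \subset M) && (#|B| == k)].

Section Draws.
Variables (T : finType).
Implicit Types M B : {set T}.

Lemma card_drawsE M k : #|draws M k| = 'C(#|M|, k).
Proof. exact: cards_draws. Qed.

Lemma card_draws_gt0 M k : (k <= #|M|)%N -> (0 < #|draws M k|)%N.
Proof. by move=> kM; rewrite card_drawsE bin_gt0. Qed.

Lemma draws_setD1 M k y : draws (M :\ y) k = [set B in draws M k | y \notin B].
Proof.
by apply/setP=> B; rewrite !inE subsetD1 andbAC.
Qed.

Lemma big_draws_setD1 (R : realType) M k y (F : {set T} -> R) :
  \sum_(B in draws M k) F B =
  \sum_(B in draws M k | y \in B) F B + \sum_(B in draws (M :\ y) k) F B.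
Proof.
rewrite (bigID (fun B => y \in B)) /=; congr (_ + _).
by apply: eq_bigl => B; rewrite draws_setD1 !inE.
Qed.

Lemma exchange_draws (R : realType) M k (F : T -> {set T} -> R) :
  \sum_(y in M) \sum_(B in draws M k | y \in B) F y B =
  \sum_(B in draws M k) \sum_(y in B) F y B.
Proof.
rewrite (exchange_big_dep (fun B => B \in draws M k)) /=; last first.
  by move=> y B _ /andP[].
apply: eq_bigr => B B_dr; apply: eq_bigl => y.
rewrite B_dr /=; case yB: (y \in B); rewrite ?andbF ?andbT //.
by move: B_dr; rewrite inE => /andP[/subsetP/(_ _ yB) -> _].
Qed.

Lemma sum_mem_draws (R : realType) M k (F : {set T} -> R) :
  \sum_(y in M) \sum_(B in draws M k | y \in B) F B =
  k%:R * \sum_(B in draws M k) F B.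
Proof.
rewrite (exchange_draws _ _ (fun=> F)) mulr_sumr; apply: eq_bigr => B.
by rewrite inE => /andP[_ /eqP B_k]; rewrite sumr_const mulr_natl B_k.
Qed.

(** Double counting of the pairs of a set and one of its elements, which is then split off. *)
Lemma big_draws_recl (R : realType) M k (F : {set T} -> R) :
  k.+1%:R * \sum_(B in draws M k.+1) F B =
  \sum_(y in M) \sum_(B in draws (M :\ y) k) F (y |: B).
Proof.
rewrite -sum_mem_draws.
apply: eq_bigr => y yM.
rewrite (reindex_onto (fun B => y |: B) (fun B => B :\ y)) /=; last first.
  by move=> B /andP[_ yB]; rewrite setD1K.
apply: eq_bigl => B; rewrite !inE eqxx /= andbT subsetD1 subUset sub1set yM /=.
case yB: (y \in B) => /=.
  rewrite andbF /=; apply/negbTE/negP => /andP[_ /eqP eqB].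
  by move: yB; rewrite -eqB !inE eqxx.
by rewrite setU1K ?yB // eqxx andbT cardsU1 yB add1n eqSS andbT.
Qed.

(** This lets a block be removed one element at a time: a uniform [k.+1]-subset is a uniform element
    together with a uniform [k]-subset of the rest. *)
Lemma avg_draws_recl (R : realType) M k (F : {set T} -> R) :
  (k < #|M|)%N ->
  avg (draws M k.+1) F =
  avg M (fun y => avg (draws (M :\ y) k) (fun B => F (y |: B))).
Proof.
move=> kM; rewrite /avg card_drawsE.
have kS : (k.+1%:R : R) != 0 by rewrite pnatr_eq0.
rewrite -[X in X / _ = _](mulKf kS) big_draws_recl.
rewrite [in RHS](eq_bigr (fun y =>
    (\sum_(B in draws (M :\ y) k) F (y |: B)) / 'C(#|M|.-1, k)%:R)); last first.
  by move=> y yM; rewrite card_drawsE (cardsD1 y M) yM.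
rewrite -mulr_suml.
have CN : #|M|%:R * 'C(#|M|.-1, k)%:R = k.+1%:R * 'C(#|M|, k.+1)%:R :> R.
  by rewrite -!natrM mul_bin_diag.
by rewrite -[LHS]mulrA [LHS]mulrCA -invfM -CN -[RHS]mulrA -[in RHS]invfM [in RHS](mulrC _%:R).
Qed.

Lemma card_draws_mem_notin M k y z :
  y \in M -> z \in M -> y != z ->
  #|[set B in draws M k.+1 | (y \in B) && (z \notin B)]| = 'C(#|M|.-2, k).
Proof.
move=> yM zM yz.
have yMz : y \in M :\ z by rewrite !inE yz.
have cMz : #|M :\ z| = #|M :\ z :\ y|.+1 by rewrite (cardsD1 y) yMz.
have cM : #|M| = #|M :\ z :\ y|.+2 by rewrite (cardsD1 z) zM add1n cMz.
have -> : [set B in draws M k.+1 | (y \in B) && (z \notin B)] =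
    draws (M :\ z) k.+1 :\: draws (M :\ z :\ y) k.+1.
  apply/setP=> B; rewrite !inE !subsetD1.
  by case: (B \subset M); case: (y \in B); case: (z \in B); case: (_ == _).
rewrite cardsD (setIidPr _) ?card_drawsE ?cMz ?cM /= ?binS ?addKn //.
by apply/subsetP=> B; rewrite !inE !subsetD1 => /andP[/andP[-> _] ->].
Qed.

End Draws.

(** As [c] sums to 0, the sum over [B] is minus the sum over its complement, so the square is minus
    the sum of [c y * c z] over [y] in [B] and [z] outside. Each ordered pair of distinct elements
    is separated by the same number of draws, and the [c z] with [z != y] sum to [- c y]. *)
Lemma sum_sqr_draws (R : realType) (T : finType) (M : {set T}) k (c : T -> R) :
  \sum_(y in M) c y = 0 ->
  \sum_(B in draws M k.+1) (\sum_(y in B) c y) ^+ 2 =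
  'C(#|M|.-2, k)%:R * \sum_(y in M) c y ^+ 2.
Proof.
move=> c0.
transitivity (\sum_(B in draws M k.+1) \sum_(y in M) \sum_(z in M)
    (- (c y * c z)) * ((y \in B) && (z \notin B))%:R).
  apply: eq_bigr => B; rewrite inE => /andP[BM _].
  have inB (F : T -> R) : \sum_(y in M) F y * (y \in B)%:R = \sum_(y in B) F y.
    rewrite [RHS](eq_bigl (fun y => (y \in M) && (y \in B))) => [|y].
      rewrite big_mkcondr /=; apply: eq_bigr => y _.
      by case: (y \in B); rewrite ?mulr1 ?mulr0.
    by rewrite andb_idl // => /(subsetP BM).
  have outB : \sum_(z in M) c z * (z \notin B)%:R = - \sum_(y in B) c y.
    apply/eqP; rewrite -addr_eq0 -(inB c) -big_split /= -[X in _ == X]c0.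
    by apply/eqP/eq_bigr => y _; case: (y \in B); rewrite /=; ring.
  rewrite expr2 -{1}(inB c) -[X in _ * X]opprK -outB -sumrN big_distrl /=.
  apply: eq_bigr => y _; rewrite mulr_sumr; apply: eq_bigr => z _.
  by case: (y \in B); case: (z \in B); rewrite /=; ring.
rewrite exchange_big mulr_sumr; apply: eq_bigr => y yM.
rewrite exchange_big /=.
have -> : \sum_(z in M) \sum_(B in draws M k.+1)
    - (c y * c z) * ((y \in B) && (z \notin B))%:R =
    \sum_(z in M | z != y) - (c y * c z) * 'C(#|M|.-2, k)%:R.
  rewrite big_mkcondr /=; apply: eq_bigr => z zM.
  rewrite -mulr_sumr; have [->|zy] /= := eqVneq z y.
    by rewrite big1 ?mulr0 // => B _; case: (y \in B).
  rewrite -natr_sum -(card_draws_mem_notin k yM zM) 1?eq_sym //.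
  rewrite -sum1dep_card big_mkcondr /=; congr (_ * _%:R).
rewrite -mulr_suml sumrN -mulr_sumr.
by move: c0; rewrite (bigD1 y) //= => /eqP; rewrite addr_eq0 => /eqP ->; ring.
Qed.

(** * Change of the density when one element is deleted *)

Section Density.
Variables (R : realType) (T : finType) (f : {set T} -> R).
Hypothesis f01 : forall B, 0 <= f B <= 1.
Implicit Types M B : {set T}.

Definition density l M : R := avg (draws M l) f.

Lemma density01 l M : (l <= #|M|)%N -> 0 <= density l M <= 1.
Proof.
move=> lM; rewrite avg_ge0 => [|B _]; last by have /andP[] := f01 B.
by rewrite avg_le_cst ?card_draws_gt0 // => B _; have /andP[] := f01 B.
Qed.

Section RemoveOne.
Variables (l : nat) (M : {set T}).
Hypothesis lM : (l.+1 < #|M|)%N.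
Let a := density l.+1 M.
Let b y : R := \sum_(B in draws M l.+1 | y \in B) (f B - a).

Let sum_centered : \sum_(B in draws M l.+1) (f B - a) = 0.
Proof.
have C0 : (#|draws M l.+1|%:R : R) != 0.
  by rewrite pnatr_eq0 -lt0n card_draws_gt0 // ltnW.
by rewrite sumrB sumr_const -[a *+ _]mulr_natr /a /density /avg divfK ?subrr.
Qed.

(** The draws from [M :\ y] are those avoiding [y]; as [f - a] sums to 0 over all draws, it sums to
    [- b y] over these. Strictness in [lM] keeps the denominator nonzero. *)
Let density_setD1 y : y \in M ->
  density l.+1 (M :\ y) - a = - b y / 'C(#|M|.-1, l.+1)%:R.
Proof.
move=> yM; have cM : #|M :\ y| = #|M|.-1 by rewrite (cardsD1 y M) yM.
have C0 : ('C(#|M|.-1, l.+1)%:R : R) != 0.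
  by rewrite pnatr_eq0 -lt0n bin_gt0; case: #|M| lM.
apply: (mulIf C0); rewrite divfK //; apply/eqP.
rewrite -addr_eq0 -sum_centered (big_draws_setD1 _ _ y) addrC -/(b y).
rewrite sumrB sumr_const -[a *+ _]mulr_natr card_drawsE cM mulrBl.
by rewrite {1}/density /avg card_drawsE cM divfK.
Qed.

Lemma sum_density_setD1 :
  \sum_(y in M) (density l.+1 (M :\ y) - density l.+1 M) = 0.
Proof.
rewrite (eq_bigr _ density_setD1) -mulr_suml sumrN /b.
by rewrite sum_mem_draws sum_centered mulr0 oppr0 mul0r.
Qed.

(** Of the draws, [P] contain [y] and [Q] avoid it. The change of density is
    [(w / Q * P - u) / (Q + P)], a difference of two numbers of [[0, P]] over [Q + P], and
    [P / (Q + P)] is the chance that a draw contains [y]. *)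
Lemma norm_density_setD1 y : y \in M ->
  `|density l.+1 (M :\ y) - density l.+1 M| <= l.+1%:R / #|M|%:R.
Proof.
move=> yM; have cM : #|M :\ y| = #|M|.-1 by rewrite (cardsD1 y M) yM.
have M1 : #|M| = #|M|.-1.+1 by case: #|M| lM.
set P : R := 'C(#|M|.-1, l)%:R; set Q : R := 'C(#|M|.-1, l.+1)%:R.
have P_gt0 : 0 < P by rewrite ltr0n bin_gt0; case: #|M| lM => //= n /ltnW.
have Q_gt0 : 0 < Q by rewrite ltr0n bin_gt0; case: #|M| lM.
have CPQ : 'C(#|M|, l.+1)%:R = Q + P :> R by rewrite -natrD M1 binS.
have -> : l.+1%:R / #|M|%:R = P / (Q + P).
  rewrite -CPQ; apply/eqP; rewrite eqr_div ?pnatr_eq0 -?lt0n ?bin_gt0 //.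
  - by rewrite -!natrM -mul_bin_diag mulnC.
  - by rewrite M1.
  - exact: ltnW.
set u := \sum_(B in draws M l.+1 | y \in B) f B.
set w := \sum_(B in draws (M :\ y) l.+1) f B.
have u01 : 0 <= u <= P.
  rewrite sumr_ge0 => [|B _]; last by have /andP[] := f01 B.
  have <- : \sum_(B in draws M l.+1 | y \in B) (1 : R) = P.
    have := big_draws_setD1 M l.+1 y (fun=> 1 : R).
    by rewrite !sumr_const !card_drawsE cM CPQ addrC => /addIr.
  by apply: ler_sum => B _; have /andP[] := f01 B.
have w01 : 0 <= w <= Q.
  rewrite sumr_ge0 => [|B _]; last by have /andP[] := f01 B.
  rewrite /Q -cM -card_drawsE -[leRHS]mulr1 mulr_natl -sumr_const.
  by apply: ler_sum => B _; have /andP[] := f01 B.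
rewrite /density /avg !card_drawsE cM CPQ (big_draws_setD1 M _ y) -/u -/w -/Q.
have QP_gt0 : 0 < Q + P by rewrite addr_gt0.
have -> : w / Q - (u + w) / (Q + P) = (w / Q * P - u) / (Q + P).
  by field; rewrite !gt_eqF.
rewrite normrM normfV (gtr0_norm QP_gt0) ler_pM2r ?invr_gt0 //.
have r01 : 0 <= w / Q <= 1.
  by have /andP[w0 w1] := w01; rewrite ler_pdivrMr // mul1r w1 divr_ge0 ?(ltW Q_gt0).
rewrite ler_norml; nra.
Qed.

(* Bessel's inequality: up to scaling, [b] lists the coefficients of the
   orthogonal projection of [f - a] onto the linear forms in the indicators of
   the elements of [M]. *)
Lemma avg_sqr_density_setD1 :
  avg M (fun y => (density l.+1 (M :\ y) - density l.+1 M) ^+ 2) <=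
  l.+1%:R / (4 * (#|M|.-1%:R * (#|M| - l.+1)%:R)).
Proof.
have M1 : #|M| = #|M|.-2.+2 by case: #|M| lM => [|[]].
set n := #|M|.-2 in M1.
pose S := \sum_(y in M) b y ^+ 2.
pose L B := \sum_(y in B) b y.
have b0 : \sum_(y in M) b y = 0 by rewrite sum_mem_draws sum_centered mulr0.
have SL : \sum_(B in draws M l.+1) (f B - a) * L B = S.
  rewrite /S; under [RHS]eq_bigr => y _ do rewrite expr2 {2}/b mulr_sumr.
  rewrite exchange_draws; apply: eq_bigr => B _.
  by rewrite mulr_sumr; apply: eq_bigr => y _; rewrite mulrC.
have LL : \sum_(B in draws M l.+1) L B ^+ 2 = 'C(n, l)%:R * S.
  exact: sum_sqr_draws.
set K : R := 'C(n, l)%:R in LL.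
have K_gt0 : 0 < K by rewrite ltr0n bin_gt0 /n; case: #|M| lM => [|[]].
set A : R := 'C(#|M|, l.+1)%:R.
have A_gt0 : 0 < A by rewrite ltr0n bin_gt0 ltnW.
have V : \sum_(B in draws M l.+1) (f B - a) ^+ 2 <= A / 4.
  have := avg_sqr_centered_le (card_draws_gt0 (ltnW lM)) (fun B _ => f01 B).
  by rewrite -/(density _ _) -/a /avg card_drawsE ler_pdivrMr // mulrC.
have bessel : S <= K * A / 4.
  (* [K^-1] is the projection coefficient: [L] has inner product [S] with [f - a] and squared norm
     [K * S]. *)
  have : 0 <= \sum_(B in draws M l.+1) (f B - a - K^-1 * L B) ^+ 2.
    by apply: sumr_ge0 => B _; apply: sqr_ge0.
  under eq_bigr => B _.
    rewrite (_ : _ ^+ 2 = (f B - a) ^+ 2 + (- 2 * K^-1) * ((f B - a) * L B) +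
      K^-1 ^+ 2 * L B ^+ 2); last by ring.
    over.
  rewrite !big_split /= -!mulr_sumr SL LL => res.
  have : K^-1 * S <= A / 4.
    have -> : K^-1 * S = - (- 2 * K^-1 * S + K^-1 ^+ 2 * (K * S)).
      by field; rewrite gt_eqF.
    by lra.
  by rewrite mulrC ler_pdivrMr // mulrC mulrA.
set Q : R := 'C(n.+1, l.+1)%:R.
have Q_gt0 : 0 < Q by rewrite ltr0n bin_gt0 -ltnS -M1.
have -> : avg M (fun y => (density l.+1 (M :\ y) - density l.+1 M) ^+ 2) =
    S / Q ^+ 2 / #|M|%:R.
  rewrite /avg /S mulr_suml; congr (_ / _); apply: eq_bigr => y yM.
  by rewrite density_setD1 // M1 /= -/Q; field; rewrite gt_eqF.
have AE : (#|M| - l.+1)%:R * A = #|M|%:R * Q.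
  by rewrite -!natrM -mul_bin_down M1.
have KE : n.+1%:R * K = l.+1%:R * Q by rewrite -!natrM mul_bin_diag.
rewrite M1 /= -M1; set d : R := (#|M| - l.+1)%:R in AE *.
have d_gt0 : 0 < d by rewrite ltr0n subn_gt0.
have N_gt0 : 0 < #|M|%:R :> R by rewrite M1 ltr0n.
have n_gt0 : 0 < n.+1%:R :> R by rewrite ltr0n.
have -> : l.+1%:R / (4 * (n.+1%:R * d)) = K * A / 4 / Q ^+ 2 / #|M|%:R.
  have -> : A = #|M|%:R * Q / d by rewrite -AE mulrC mulKf ?gt_eqF.
  have -> : K = l.+1%:R * Q / n.+1%:R by rewrite -KE mulrC mulKf ?gt_eqF.
  by field; rewrite nat1r !gt_eqF.
by rewrite !ler_pM2r ?invr_gt0 ?exprn_gt0.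
Qed.

End RemoveOne.
End Density.

(** * Change of the density when a whole block is deleted *)

Lemma avg_draws0 (R : realType) (T : finType) (M : {set T}) (F : {set T} -> R) :
  avg (draws M 0) F = F set0.
Proof.
have -> : draws M 0 = [set set0].
  by apply/setP=> B; rewrite !inE cards_eq0 andbC; case: eqP => // ->; rewrite sub0set.
by rewrite /avg big_set1 cards1 divr1.
Qed.

Section RemoveMany.
Variables (R : realType) (T : finType) (f : {set T} -> R).
Hypothesis f01 : forall B, 0 <= f B <= 1.
Variable l : nat.
Implicit Types M B : {set T}.
Local Notation density := (density f l.+1).

Lemma avg_density_setD1 M : (l.+1 < #|M|)%N ->
  avg M (fun y => density (M :\ y)) = density M.
Proof.
move=> lM; have M_gt0 : (0 < #|M|)%N by apply: leq_trans lM.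
apply/eqP; rewrite -subr_eq0 -(avg_cst M_gt0 (- density M)) -avgD.
by rewrite /avg sum_density_setD1 // mul0r.
Qed.

Lemma avg_density_setD M k : (k + l.+1 <= #|M|)%N ->
  avg (draws M k) (fun B => density (M :\: B)) = density M.
Proof.
elim: k M => [|k IHk] M kM; first by rewrite avg_draws0 setD0.
rewrite avg_draws_recl; last by apply: leq_trans kM; rewrite addSn ltnS leq_addr.
rewrite -avg_density_setD1; last by apply: leq_trans kM; rewrite addSn ltnS leq_addl.
apply: eq_avg => y yM; rewrite -IHk; last first.
  by move: kM; rewrite (cardsD1 y M) yM.
by apply: eq_avg => B _; rewrite setDDl.
Qed.

(** Every deletion starts from a set with more than [n] elements, so by [avg_expR_le] it costs a
    factor of at most [expR (c ^+ 2 * v)]. *)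
Lemma avg_expR_density_setD n c v M k :
  (l < n)%N -> (k + n <= #|M|)%N ->
  (forall N, (n < N)%N -> `|c| * (l.+1%:R / N%:R) <= 2^-1) ->
  (forall N, (n < N)%N -> l.+1%:R / (4 * (N.-1%:R * (N - l.+1)%:R)) <= v) ->
  avg (draws M k) (fun B => expR (c * density (M :\: B))) <=
  expR (c * density M + k%:R * (c ^+ 2 * v)).
Proof.
move=> ln + c_le v_ge; elim: k M => [|k IHk] M kM.
  by rewrite avg_draws0 setD0 mul0r addr0.
have nM : (n < #|M|)%N by apply: leq_trans kM; rewrite addSn ltnS leq_addl.
rewrite avg_draws_recl; last by apply: leq_trans kM; rewrite addSn ltnS leq_addr.
have lM : (l.+1 < #|M|)%N by apply: leq_ltn_trans nM.
have M_gt0 : (0 < #|M|)%N by apply: leq_trans lM.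
set a := density M; pose D y := density (M :\ y) - a.
apply: (@le_trans _ _ (avg M (fun y =>
    expR (c * a + k%:R * (c ^+ 2 * v)) * expR (c * D y)))).
  apply: avg_le => y yM; rewrite (eq_avg (H := fun B => expR (c * density (M :\ y :\: B)))); last first.
    by move=> B _; rewrite setDDl.
  rewrite -expRD; apply: le_trans (IHk _ _) _.
    by move: kM; rewrite (cardsD1 y M) yM.
  by rewrite ler_expR /D; lra.
rewrite avgZ -[k.+1]addn1 natrD mulrDl mul1r addrA [leRHS]expRD.
rewrite ler_pM2l ?expR_gt0 //; apply: avg_expR_le => // [|y yM|].
- by rewrite avgZ avgD avg_cst // avg_density_setD1 // subrr mulr0.
- rewrite normrM; apply: le_trans (c_le _ nM).
  by rewrite ler_wpM2l // norm_density_setD1.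
rewrite (eq_avg (H := fun y => c ^+ 2 * D y ^+ 2)) => [|y _]; last by rewrite exprMn.
rewrite avgZ ler_wpM2l ?sqr_ge0 //; apply: le_trans (v_ge _ nM).
exact: avg_sqr_density_setD1.
Qed.

Lemma avg_expR_density_block s mu M :
  (s.+1 * l.+1 <= #|M|)%N -> `|mu| <= 2^-1 ->
  avg (draws M l.+1)
    (fun B => expR (mu * (s%:R * (density (M :\: B) - density M)))) <=
  expR (mu ^+ 2 / 2).
Proof.
move=> sM mu_le; have lM : (l.+1 <= #|M|)%N.
  by apply: leq_trans sM; rewrite mulSn leq_addr.
case: s sM => [|[|s]] sM.
- rewrite (eq_avg (H := fun=> 1)) => [|B _]; last by rewrite mul0r mulr0 expR0.
  rewrite avg_cst ?card_draws_gt0 //; apply: le_trans (expR_ge1Dx _).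
  by rewrite lerDl divr_ge0 ?sqr_ge0.
(* With one block to come, the elementwise variance bound is too weak, as [N - l.+1] may get down to
   1. But the remaining density itself lies in [[0, 1]] and has mean [density M]. *)
- have llM : (l.+1 + l.+1 <= #|M|)%N by rewrite addnn -mul2n.
  rewrite -(avg_density_setD llM).
  rewrite (eq_avg (H := fun B => expR (mu * (density (M :\: B) -
    avg (draws M l.+1) (fun B' => density (M :\: B')))))) => [|B _]; last by rewrite mul1r.
  apply: avg_expR_centered_le mu_le => // [|B]; first exact: card_draws_gt0.
  rewrite inE => /andP[BM /eqP cB]; apply: density01 => //.
  by rewrite cardsD (setIidPr BM) cB leq_subRL.
set S := s.+2 in sM *; have S_gt1 : (1 < S)%N by [].
(* Chosen so that [l.+1] deletions, each costing [(mu * S) ^+ 2 * v], add up to [mu ^+ 2 / 2]. *)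
set v : R := (2 * S%:R ^+ 2 * l.+1%:R)^-1.
have L1 : 1 <= l.+1%:R :> R by rewrite ler1n.
have S2 : 2 <= S%:R :> R by rewrite ler_nat.
have c_le N : (S * l.+1 < N)%N -> `|mu * S%:R| * (l.+1%:R / N%:R) <= 2^-1.
  move=> ltN; have N_gt : S%:R * l.+1%:R <= N%:R :> R by rewrite -natrM ler_nat ltnW.
  have N_gt0 : 0 < N%:R :> R by nra.
  rewrite normrM normr_nat -mulrA mulrA; apply: le_trans mu_le.
  rewrite -mulrA ler_piMr // mulrA ler_pdivrMr // mul1r //.
have v_ge N : (S * l.+1 < N)%N ->
    l.+1%:R / (4 * (N.-1%:R * (N - l.+1)%:R)) <= v.
  move=> ltN.
  have N1 : S%:R * l.+1%:R <= N.-1%:R :> R.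
    by rewrite -natrM ler_nat -ltnS prednK // (leq_ltn_trans _ ltN).
  have NL : S.-1%:R * l.+1%:R <= (N - l.+1)%:R :> R.
    rewrite -natrM ler_nat leq_subRL; last by apply: ltnW; apply: leq_ltn_trans ltN; rewrite leq_pmull.
    by rewrite -mulSn ltnW.
  have SS : S%:R = S.-1%:R + 1 :> R by rewrite natr1.
  (* This rests on [S <= 2 * (S - 1)], hence the separate treatment of a single remaining block. *)
  have key : S%:R ^+ 2 * l.+1%:R ^+ 2 <= 2 * (N.-1%:R * (N - l.+1)%:R) :> R.
    apply: (@le_trans _ _ (2 * ((S%:R * l.+1%:R) * (S.-1%:R * l.+1%:R)))); last first.
      rewrite ler_pM2l // ler_pM // mulr_ge0 //.
    have -> : 2 * (S%:R * l.+1%:R * (S.-1%:R * l.+1%:R)) =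
      (S%:R * l.+1%:R ^+ 2) * (2 * S.-1%:R) :> R by ring.
    have -> : S%:R ^+ 2 * l.+1%:R ^+ 2 = (S%:R * l.+1%:R ^+ 2) * S%:R :> R by ring.
    by rewrite ler_wpM2l ?mulr_ge0 ?sqr_ge0 //; lra.
  have P_gt0 : 0 < N.-1%:R * (N - l.+1)%:R :> R.
    have : 0 < S%:R ^+ 2 * l.+1%:R ^+ 2 :> R by rewrite mulr_gt0 ?exprn_gt0 //; lra.
    by lra.
  have D_gt0 : 0 < 4 * (N.-1%:R * (N - l.+1)%:R) :> R by lra.
  rewrite ler_pdivrMr // /v mulrC ler_pdivlMr; last first.
    by rewrite !mulr_gt0 ?exprn_gt0 //; lra.
  have -> : l.+1%:R * (2 * S%:R ^+ 2 * l.+1%:R) = 2 * (S%:R ^+ 2 * l.+1%:R ^+ 2) :> R by ring.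
  by lra.
have lS : (l < S * l.+1)%N by rewrite leq_pmull.
have cM : (l.+1 + S * l.+1 <= #|M|)%N by rewrite -mulSn.
have bound := avg_expR_density_setD lS cM c_le v_ge.
rewrite (eq_avg (H := fun B => expR (- (mu * S%:R * density M)) *
    expR (mu * S%:R * density (M :\: B)))) => [|B _]; last first.
  by rewrite -expRD; congr expR; ring.
rewrite avgZ; apply: le_trans (ler_wpM2l (expR_ge0 _) bound) _.
rewrite -expRD ler_expR /v.
have -> : - (mu * S%:R * density M) + (mu * S%:R * density M +
    l.+1%:R * ((mu * S%:R) ^+ 2 * (2 * S%:R ^+ 2 * l.+1%:R)^-1)) = mu ^+ 2 / 2.
  by field; rewrite !gt_eqF //; lra.
by [].
Qed.

End RemoveMany.

(** * Moment generating function of the number of hits *)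

(** Decouples the two dependent parts of a block increment. The doubled exponents are why [lam] is
    limited to [1/4] when the one-part bounds allow [1/2]. *)
Lemma expRD_le (R : realType) (x y : R) :
  expR (x + y) <= 2^-1 * expR (2 * x) + 2^-1 * expR (2 * y).
Proof.
rewrite expRD !(mulrDl 1 1) !mul1r !expRD.
have := sqr_ge0 (expR x - expR y); nra.
Qed.

Section BlockMgf.
Variables (R : realType) (T : finType) (f : {set T} -> R) (l : nat) (lam : R).
Implicit Types M B : {set T}.

(** The expectation of [expR (lam * eta)], where [eta] is the sum of [f] over [s] blocks drawn from
    [M] in succession without replacement. *)
Fixpoint block_mgf s M : R :=
  if s is s'.+1 then
    avg (draws M l) (fun B => expR (lam * f B) * block_mgf s' (M :\: B))
  else 1.

End BlockMgf.

(** Induction on the blocks still to be drawn. After [E] is factored out, the increment splits into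
    the surprise of the block itself, [Y], and the drift of the density, [Z]; each averages to at
    most [expR (2 * lam ^+ 2)], the cost per block. *)
Lemma block_mgf_le (R : realType) (T : finType) (f : {set T} -> R) l lam s (M : {set T}) :
  (forall B, 0 <= f B <= 1) -> (s * l.+1 <= #|M|)%N -> `|lam| <= 4^-1 ->
  block_mgf f l.+1 lam s M <=
  expR (lam * (s%:R * density f l.+1 M) + 2 * lam ^+ 2 * s%:R).
Proof.
move=> f01 + lam_le; elim: s M => [|s IHs] M sM /=.
  by rewrite mul0r !mulr0 addr0 expR0.
have lM : (l.+1 <= #|M|)%N by apply: leq_trans sM; rewrite mulSn leq_addr.
have M0 := card_draws_gt0 lM.
have mu_le : `|2 * lam| <= 2^-1 by rewrite normrM normr_nat; lra.
set a := density f l.+1 M.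
pose E := expR (lam * (s.+1%:R * a) + 2 * lam ^+ 2 * s%:R).
pose Y B := expR (2 * lam * (f B - a)).
pose Z B := expR (2 * lam * (s%:R * (density f l.+1 (M :\: B) - a))).
apply: (@le_trans _ _ (avg (draws M l.+1)
    (fun B => E * (2^-1 * Y B + 2^-1 * Z B)))).
  apply: avg_le => B; rewrite inE => /andP[BM /eqP cB].
  have sMB : (s * l.+1 <= #|M :\: B|)%N.
    by rewrite cardsD (setIidPr BM) cB leq_subRL // -mulSn.
  apply: le_trans (ler_wpM2l (expR_ge0 _) (IHs _ sMB)) _.
  rewrite -expRD.
  have -> : lam * f B + (lam * (s%:R * density f l.+1 (M :\: B)) + 2 * lam ^+ 2 * s%:R) =
    (lam * (s.+1%:R * a) + 2 * lam ^+ 2 * s%:R) +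
    (lam * (f B - a) + lam * (s%:R * (density f l.+1 (M :\: B) - a))).
    by rewrite -natr1; ring.
  rewrite expRD ler_pM2l ?expR_gt0 //.
  by apply: le_trans (expRD_le _ _) _; rewrite /Y /Z -!(mulrA 2 lam).
rewrite avgZ avgD !avgZ.
have Y_le : avg (draws M l.+1) Y <= expR ((2 * lam) ^+ 2 / 2).
  by apply: avg_expR_centered_le.
have Z_le : avg (draws M l.+1) Z <= expR ((2 * lam) ^+ 2 / 2).
  exact: avg_expR_density_block.
apply: (@le_trans _ _ (E * expR ((2 * lam) ^+ 2 / 2))).
  by rewrite ler_pM2l ?expR_gt0 //; lra.
by rewrite -expRD ler_expR -natr1; lra.
Qed.

(** * Tuples of disjoint blocks as successive draws *)

(** Stated on sequences, so that the first block can be peeled off and the rest is a packing of its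
    complement in [M]. *)
Definition is_packing (T : finType) (l : nat) (M : {set T}) (s : seq {set T}) :=
  all (mem (draws M l)) s && pairwise (fun A B : {set T} => [disjoint A & B]) s.

Section Packings.
Variables (T : finType) (l : nat).
Implicit Types (M S : {set T}) (s : seq {set T}).

Lemma is_packing_cons M S s :
  is_packing l M (S :: s) = (S \in draws M l) && is_packing l (M :\: S) s.
Proof.
rewrite /is_packing /= -!andbA; congr andb; rewrite andbA; congr andb.
rewrite -all_predI; apply: eq_all => A.
by rewrite /= !inE subsetD andbAC (disjoint_sym S).
Qed.

Lemma big_tuple_cons (R : realType) n (P : pred (seq {set T}))
    (F : seq {set T} -> R) :
  \sum_(B : n.+1.-tuple {set T} | P B) F B =
  \sum_(S : {set T}) \sum_(B : n.-tuple {set T} | P (S :: B)) F (S :: B).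
Proof.
rewrite pair_big_dep /=.
rewrite (reindex (fun p : {set T} * n.-tuple {set T} => [tuple of p.1 :: p.2])) //=.
exists (fun B : n.+1.-tuple {set T} => (thead B, [tuple of behead B])) => [[S B] _|B _] /=.
  by congr pair; apply: val_inj.
by rewrite [RHS](tuple_eta B).
Qed.

Fixpoint packing_count t n : nat :=
  if t is t'.+1 then ('C(n, l) * packing_count t' (n - l))%N else 1%N.

(** A uniform packing is a succession of uniform draws because the number of ways to complete a
    first block depends only on the size of what remains, not on the block. *)
Lemma sum_packing (R : realType) (f : {set T} -> R) lam t M :
  (t * l <= #|M|)%N ->
  \sum_(B : t.-tuple {set T} | is_packing l M B) expR (lam * \sum_(S <- B) f S) =
  (packing_count t #|M|)%:R * block_mgf f l lam t M.
Proof.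
elim: t M => [|t IHt] M tM /=.
  rewrite mulr1 (big_pred1 [tuple]) => [|B]; first by rewrite big_nil mulr0 expR0.
  by rewrite (tuple0 B); apply/esym/eqP.
have lM : (l <= #|M|)%N by apply: leq_trans tM; rewrite mulSn leq_addr.
rewrite (big_tuple_cons _ (is_packing l M)
  (fun s => expR (lam * \sum_(S <- s) f S))).
rewrite (bigID (mem (draws M l))) /= [X in _ + X]big1 ?addr0; last first.
  by move=> S SM; rewrite big_pred0 // => B; rewrite is_packing_cons (negbTE SM).
rewrite /avg card_drawsE natrM.
have C0 : ('C(#|M|, l)%:R : R) != 0 by rewrite pnatr_eq0 -lt0n bin_gt0.
set p := packing_count t _; set X := (X in _ = _ * (X / _)).
have -> : 'C(#|M|, l)%:R * p%:R * (X / 'C(#|M|, l)%:R) = p%:R * X :> R by field.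
rewrite mulr_sumr; apply: eq_bigr => S S_dr.
have cMS : #|M :\: S| = (#|M| - l)%N.
  by move: S_dr; rewrite inE => /andP[SM /eqP cS]; rewrite cardsD (setIidPr SM) cS.
have tMS : (t * l <= #|M :\: S|)%N by rewrite cMS leq_subRL // -mulSn.
rewrite mulrCA /p -cMS -IHt // mulr_sumr; apply: eq_big => B.
  by rewrite is_packing_cons S_dr.
by rewrite big_cons mulrDr expRD.
Qed.

Lemma block_mgf0 (R : realType) (f : {set T} -> R) t M :
  (t * l <= #|M|)%N -> block_mgf f l 0 t M = 1.
Proof.
elim: t M => [//|t IHt] M tM /=.
have lM : (l <= #|M|)%N by apply: leq_trans tM; rewrite mulSn leq_addr.
rewrite (eq_avg (H := fun=> 1)) => [|B]; first by rewrite avg_cst // card_draws_gt0.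
rewrite inE => /andP[BM /eqP cB]; rewrite mul0r expR0 mul1r IHt //.
by rewrite cardsD (setIidPr BM) cB leq_subRL // -mulSn.
Qed.

(** Counting is the case [lam = 0] of [sum_packing]. *)
Lemma card_packing (R : realType) t M : (t * l <= #|M|)%N ->
  #|[set B : t.-tuple {set T} | is_packing l M B]|%:R =
  (packing_count t #|M|)%:R :> R.
Proof.
move=> tM; have := sum_packing (fun=> 0 : R) 0 tM.
rewrite block_mgf0 // mulr1 => <-.
rewrite -sum1dep_card natr_sum; apply: eq_bigr => B _.
by rewrite mul0r expR0.
Qed.

Lemma packing_count_gt0 t n : (t * l <= n)%N -> (0 < packing_count t n)%N.
Proof.
elim: t n => [//|t IHt] n tn /=.
have ln : (l <= n)%N by apply: leq_trans tn; rewrite mulSn leq_addr.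
by rewrite muln_gt0 bin_gt0 ln IHt // leq_subRL // -mulSn.
Qed.

End Packings.

(** * The Chernoff bound for [hits] *)

Lemma disjoint_tuplesE m l t :
  disjoint_tuples m l t = [set B : t.-tuple {set 'I_m} | is_packing l setT B].
Proof.
apply/setP=> B; rewrite !inE; congr andb.
  apply/forallP/allP => [BP S /tnthP[i ->]|BP i]; last first.
    by have := BP _ (mem_tnth i B); rewrite !inE subsetT.
  by have := BP i; rewrite !inE subsetT.
apply/forallP/(pairwiseP set0) => [BP i j|BP i].
  rewrite !inE size_tuple => it jt ij.
  have /forallP/(_ (Ordinal jt)) := BP (Ordinal it).
  rewrite !(tnth_nth set0) => /implyP; apply.
  by rewrite -val_eqE /= neq_ltn ij.
apply/forallP => j; apply/implyP; rewrite -val_eqE /= neq_ltn !(tnth_nth set0).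
case/orP => ij; last rewrite disjoint_sym; apply: BP; by rewrite ?inE ?size_tuple.
Qed.

(** Blocks of size [l.+1] are nonempty, so disjoint ones differ and the tuple has no repetition. *)
Lemma hitsE (R : realType) m l t (G : {set {set 'I_m}}) (B : t.-tuple {set 'I_m}) :
  B \in disjoint_tuples m l.+1 t ->
  (hits G B)%:R = \sum_(S <- B) (S \in G)%:R :> R.
Proof.
rewrite disjoint_tuplesE inE => /andP[BP pB].
have uB : uniq B.
  rewrite uniq_pairwise; apply: (sub_in_pairwise _ BP pB) => S S' /= S_dr _ dS.
  apply: contraTneq S_dr => eqS; move: dS; rewrite -eqS -setI_eq0 setIid => /eqP ->.
  by rewrite inE cards0 andbF.
rewrite -natr_sum big_uniq //= /hits; congr (_%:R).
rewrite -sum1_card; under eq_bigl => S do rewrite inE andbC inE.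
by rewrite big_mkcondr /=; apply: eq_bigr => S _; case: ifP.
Qed.

Theorem theorem12 (R : realType) (m l t : nat)
    (m_gt0 : (0 < m)%N) (l_gt0 : (0 < l)%N) (t_gt0 : (0 < t)%N)
    (tl_le_m : (t * l <= m)%N)
    (G : {set {set 'I_m}}) (G_sub : G \subset l_subsets m l)
    (beta : R) (beta_gt0 : 0 < beta) :
  unif_pr R (disjoint_tuples m l t)
    (fun B => 2 * beta * Num.sqrt t%:R
              <= `|(hits G B)%:R - family_density R l G * t%:R|)
  <= 2 * expR (- (beta ^+ 2 / 2)).
Proof.
case: l l_gt0 tl_le_m G_sub => // l _ tl_le_m G_sub.
pose f (S : {set 'I_m}) : R := (S \in G)%:R.
have f01 S : 0 <= f S <= 1 by rewrite /f; case: (S \in G); rewrite ?lexx ?ler01.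
set Omega := disjoint_tuples m l.+1 t.
have lm : (l.+1 <= m)%N by apply: leq_trans tl_le_m; rewrite leq_pmull.
have tlT : (t * l.+1 <= #|[set: 'I_m]|)%N by rewrite cardsT card_ord.
have -> : family_density R l.+1 G = density f l.+1 setT.
  rewrite /family_density /density /avg card_drawsE cardsT card_ord; congr (_ / _).
  rewrite /f -natr_sum -sum1_card; congr (_%:R).
  rewrite big_mkcond [RHS]big_mkcond /=; apply: eq_bigr => S _.
  rewrite !inE subsetT /=; case: ifP => SG; last by case: ifP.
  by have := subsetP G_sub _ SG; rewrite inE => ->.
set a := density f l.+1 setT.
have a01 : 0 <= a <= 1 by apply: density01 => //; rewrite cardsT card_ord.
pose X (B : t.-tuple {set 'I_m}) : R := (hits G B)%:R - a * t%:R.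
have cO : #|Omega|%:R = (packing_count l.+1 t m)%:R :> R.
  by rewrite /Omega disjoint_tuplesE card_packing // cardsT card_ord.
have O_gt0 : 0 < #|Omega|%:R :> R by rewrite cO ltr0n packing_count_gt0.
have mgf lam : `|lam| <= 4^-1 ->
    \sum_(B in Omega) expR (lam * X B) <= #|Omega|%:R * expR (2 * lam ^+ 2 * t%:R).
  move=> lam_le.
  have -> : \sum_(B in Omega) expR (lam * X B) = expR (- (lam * (t%:R * a))) *
      \sum_(B : t.-tuple {set 'I_m} | is_packing l.+1 setT B) expR (lam * \sum_(S <- B) f S).
    rewrite mulr_sumr; apply: eq_big => [B|B BO].
      by rewrite /Omega disjoint_tuplesE inE.
    by rewrite -expRD /X (hitsE R G BO); congr expR; rewrite /f; ring.
  rewrite sum_packing // cardsT card_ord -cO mulrCA ler_pM2l //.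
  apply: le_trans (ler_wpM2l (expR_ge0 _) (block_mgf_le f01 tlT lam_le)) _.
  by rewrite -expRD ler_expR -/a; lra.
have st_gt0 : 0 < Num.sqrt t%:R :> R by rewrite sqrtr_gt0 ltr0n.
have stE : Num.sqrt t%:R ^+ 2 = t%:R :> R by rewrite sqr_sqrtr.
set st := Num.sqrt t%:R in st_gt0 stE *.
rewrite /unif_pr ler_pdivrMr //.
(* For large [beta] the threshold exceeds [t], while both [hits G B] and [a * t] lie in [[0, t]]. *)
have [beta_le|beta_gt] := lerP beta (st / 2); last first.
  rewrite [X in X%:R](_ : _ = 0%N) ?mulr_ge0 ?expR_ge0 ?ler0n //.
  apply: eq_card0 => B; apply/negbTE; rewrite in_set; apply/negP => /andP[BO].
  apply/negP; rewrite -ltNge.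
  have hits_le : (hits G B)%:R <= t%:R :> R.
    rewrite (hitsE R G BO) -natr_sum ler_nat -[X in (_ <= X)%N](size_tuple B) -sum1_size.
    by apply: leq_sum => S _; case: (S \in G).
  have hits_ge : 0 <= (hits G B)%:R :> R := ler0n _ _.
  have : t%:R < 2 * beta * st by rewrite -stE; nra.
  have t0 : 0 <= t%:R :> R := ler0n _ _.
  rewrite ltr_norml; nra.
(* The minimiser of [2 * lam ^+ 2 * t - lam * (2 * beta * st)], with minimum [- (beta ^+ 2 / 2)]. *)
pose lam := beta / (2 * st).
have lam_ge0 : 0 <= lam by rewrite divr_ge0 ?mulr_ge0 ?ltW.
have lam_le : `|lam| <= 4^-1.
  by rewrite ger0_norm // ler_pdivrMr ?mulr_gt0 //; lra.
have lamN_le : `|- lam| <= 4^-1 by rewrite normrN.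
pose e := expR (- (beta ^+ 2)).
have ee : expR (lam * (2 * beta * st)) * e = 1.
  by rewrite -expRD -[RHS]expR0; congr expR; rewrite /lam; field; rewrite gt_eqF.
(* Both tails at once: on the event, one of the two exponentials is at least [e^-1]. *)
have markov : #|[set B in Omega | 2 * beta * st <= `|X B|]|%:R <=
    \sum_(B in Omega) e * (expR (lam * X B) + expR (- lam * X B)).
  rewrite -sum1dep_card natr_sum big_mkcondr /=; apply: ler_sum => B _.
  case: ifP => [X_ge|_]; last by rewrite mulr_ge0 ?addr_ge0 ?expR_ge0.
  rewrite -[leLHS]ee mulrC ler_pM2l ?expR_gt0 //.
  have [X0|X0] := lerP 0 (X B).
    apply: (@le_trans _ _ (expR (lam * X B))); last by rewrite lerDl expR_ge0.
    by rewrite ler_expR ler_wpM2l // -(ger0_norm X0).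
  apply: (@le_trans _ _ (expR (- lam * X B))); last by rewrite lerDr expR_ge0.
  by rewrite mulNr -mulrN ler_expR ler_wpM2l // -(ltr0_norm X0).
apply: le_trans markov _.
rewrite -mulr_sumr big_split /=.
apply: (@le_trans _ _ (e * (2 * (#|Omega|%:R * expR (2 * lam ^+ 2 * t%:R))))).
  rewrite ler_pM2l ?expR_gt0 //.
  by have := mgf _ lam_le; have := mgf _ lamN_le; rewrite sqrrN; lra.
have -> : expR (- (beta ^+ 2 / 2)) = e * expR (2 * lam ^+ 2 * t%:R).
  by rewrite -expRD -stE; congr expR; rewrite /lam; field; rewrite gt_eqF.
by lra.
Qed.
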